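(* For every $i\in\mathbb N$, there exists a collection of languages that is generatable in the limit with $i$ omissions or with noise level $i$, but is not generatable in the limit with either $i+1$ omissions or with noise level $i+1$.
   Context: A language is an infinite subset of a countably infinite universe $U$; a collection is a set of languages. A generator algorithm is an arbitrary function $G$ from finite sequences of elements of $U$ to $U$, with output $z_t=G(x_0,\dots,x_t)$ at time $t$, and $S_t=\{x_0,\dots,x_t\}$. An enumeration of $K$ with $i$ omissions is an infinite sequence $x_0,x_1,\dots$ of pairwise distinct elements with $\bigcup_j\{x_j\}\subseteq K$ and $|K\setminus\bigcup_j\{x_j\}|\le i$. A noisy enumeration of $K$ with noise level $i$ is an infinite sequence of pairwise distinct elements of $U$ with $K\subseteq\bigcup_j\{x_j\}$ and $|\bigcup_j\{x_j\}\setminus K|\le i$. $G$ generates in the limit with $i$ omissions (resp. with noise level $i$) for $\mathcal C$ if for every $K\in\mathcal C$ and every enumeration $x$ of $K$ with $i$ omissions (resp. every noisy enumeration of $K$ with noise level at most $i$) there is $t^\star$ such that $z_t\in K\setminus S_t$ for all $t\ge t^\star$. A collection has the property if some $G$ achieves it. The same collection is claimed to witness both separations. *)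

(* Defs.v *)
From mathcomp Require Import all_boot.
From mathcomp Require Import boolp classical_sets functions cardinality.

Set Implicit Arguments.
Unset Strict Implicit.
Unset Printing Implicit Defensive.

Local Open Scope classical_set_scope.
Local Open Scope card_scope.

Definition language (U : Type) (K : set U) : Prop := infinite_set K.

Definition collection (U : Type) (C : set (set U)) : Prop :=
  forall K, C K -> language K.

(* Generators are arbitrary functions: no computability is required. *)
Definition generator (U : Type) : Type := seq U -> U.

Definition output (U : Type) (G : generator U) (x : nat -> U) (t : nat) : U :=
  G (mkseq x t.+1).

Definition shown (U : Type) (x : nat -> U) (t : nat) : set U :=
  [set x j | j in [set j | j <= t]].

(* `I_i is the set of naturals below i, so [A #<= `I_i] says |A| <= i. *)
Definition enum_omissions (U : Type) (i : nat) (K : set U) (x : nat -> U) : Prop :=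
  [/\ injective x, range x `<=` K & (K `\` range x) #<= `I_i].

Definition enum_noise (U : Type) (i : nat) (K : set U) (x : nat -> U) : Prop :=
  [/\ injective x, K `<=` range x & (range x `\` K) #<= `I_i].

Definition eventually_correct (U : Type) (G : generator U) (K : set U)
    (x : nat -> U) : Prop :=
  exists tstar : nat, forall t : nat, tstar <= t ->
    (K `\` shown x t) (output G x t).

Definition generates_omissions (U : Type) (i : nat) (C : set (set U))
    (G : generator U) : Prop :=
  forall K, C K -> forall x, enum_omissions i K x -> eventually_correct G K x.

Definition generates_noise (U : Type) (i : nat) (C : set (set U))
    (G : generator U) : Prop :=
  forall K, C K -> forall x, enum_noise i K x -> eventually_correct G K x.

Definition generatable_omissions (U : Type) (i : nat) (C : set (set U)) : Prop :=
  exists G : generator U, generates_omissions i C G.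

Definition generatable_noise (U : Type) (i : nat) (C : set (set U)) : Prop :=
  exists G : generator U, generates_noise i C G.

(* Main.v *)
Require Import Defs.
From mathcomp Require Import all_boot.
From mathcomp Require Import boolp classical_sets functions cardinality.
From mathcomp Require Import zify.

Local Open Scope classical_set_scope.
Local Open Scope card_scope.

(** Split the universe into a set [s] of [i + 1] markers and two infinite
    sequences [p] and [q].  The collection consists of the languages that contain
    all markers and all of [p], and of those that contain no marker and almost all
    of [q].  With at most [i] omissions, a language of the first kind shows some
    marker and one of the second kind shows none; with noise at most [i], one of
    the first kind shows all markers and one of the second kind does not.  So the
    generator learns the kind and then outputs fresh elements of [p] or of [q].

    With [i + 1] omissions (resp. noise level [i + 1]) the adversary can hide
    (resp. show) all markers whatever the kind.  It enumerates a tail of [q] until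
    the generator, which must allow for the second kind, outputs a fresh [q r];
    then it gives up [q r], shows the next element of [p], and starts again with a
    later tail of [q].  In the limit all of [p] is shown, so the target may be of
    the first kind, but none of the [q r] is in it. *)

(** * Finite sets, fresh elements and finite prefixes *)

Lemma card_seq_set (T : eqType) (s : seq T) :
  uniq s -> [set` s] #= `I_(size s).
Proof.
case: s => [|a s] us.
  by rewrite set_nil II0.
have -> : [set` a :: s] = nth a (a :: s) @` `I_(size (a :: s)).
  apply/seteqP; split=> [y ys|_ [k /= ks <-]]; last exact: mem_nth.
  by exists (index y (a :: s)); [rewrite /mkset index_mem|rewrite nth_index].
apply: inj_card_eq => j k; rewrite !inE /= => hj hk /eqP.
by rewrite nth_uniq// => /eqP.
Qed.

Lemma infinite_set_range (T : Type) (f : nat -> T) (K : set T) :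
  injective f -> (forall n, K (f n)) -> infinite_set K.
Proof.
move=> fI fK; apply: (@sub_infinite_set _ (range f)); first by move=> _ [n _ <-].
have /card_eqPle[_ le] : range f #= [set: nat].
  by apply: inj_card_eq => a b _ _ /fI.
exact/infiniteP.
Qed.

(** Pigeonhole on [size l + 1] consecutive indices. Starting them at [size l] makes the chosen index
    grow with time, hence pass any threshold unknown to the generator. *)
Lemma fresh_index (T : eqType) (f : nat -> T) (l : seq T) :
  injective f -> exists n, size l <= n /\ f n \notin l.
Proof.
move=> fI; apply: contrapT => /forallNP h.
have sub : {subset map f (iota (size l) (size l).+1) <= l}.
  move=> y /mapP[n]; rewrite mem_iota => /andP[ln _] ->.
  by apply/negPn/negP => ?; apply: (h n).
have := uniq_leq_size _ sub.
by rewrite map_inj_uniq// iota_uniq size_map size_iota ltnn => /(_ isT).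
Qed.

Lemma mem_shown (T : eqType) (x : nat -> T) t y :
  shown x t y <-> y \in mkseq x t.+1.
Proof.
split=> [[j /= jt <-]|/mapP[j]]; first by apply: map_f; rewrite mem_iota.
by rewrite mem_iota => /andP[_ jt] ->; exists j.
Qed.

(** * The marker collection and its generators *)

Section MarkerCollection.
Variables (T : choiceType) (s : seq T) (p q : nat -> T).
Hypotheses (us : uniq s) (pI : injective p) (qI : injective q).
Hypotheses (pNq : forall m n, p m <> q n).
Hypotheses (pNs : forall n, p n \notin s) (qNs : forall n, q n \notin s).

Definition marked (K : set T) := [set` s] `<=` K /\ range p `<=` K.

Definition unmarked (K : set T) :=
  (forall y, y \in s -> ~ K y) /\ (exists N, forall n, N <= n -> K (q n)).

Definition marker_collection : set (set T) := [set K | marked K \/ unmarked K].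

Lemma marker_collection_infinite : collection marker_collection.
Proof.
move=> K [[_ pK]|[_ [N qK]]].
  by apply: (infinite_set_range _ _ _ pI) => n; apply: pK; exists n.
apply: (infinite_set_range _ (fun n => q (N + n))) => [m n /qI|n]; first lia.
by apply: qK; lia.
Qed.

Definition switch (b : seq T -> bool) (f g : seq T -> nat) : generator T :=
  fun l => if b l then p (f l) else q (g l).

(** In the marked case every fresh [p] is right once the test has settled. In the unmarked case [g]
    returns an index above [t], so its outputs are right from time [N] on. *)
Lemma switch_correct (b : seq T -> bool) f g K x :
  (forall l, size l <= f l /\ p (f l) \notin l) ->
  (forall l, size l <= g l /\ q (g l) \notin l) ->
  marked K /\ (exists t0, forall t, t0 <= t -> b (mkseq x t.+1)) \/
  unmarked K /\ (forall t, ~~ b (mkseq x t.+1)) ->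
  eventually_correct (switch b f g) K x.
Proof.
move=> fP gP [[[_ pK] [t0 bt]]|[[_ [N qK]] bF]].
  exists t0 => t /bt bx; rewrite /output /switch bx.
  split; first by apply: pK; exists (f (mkseq x t.+1)).
  by rewrite mem_shown; apply/negP; case: (fP (mkseq x t.+1)).
exists N => t Nt; rewrite /output /switch (negPf (bF t)).
have [] := gP (mkseq x t.+1); rewrite size_mkseq => tg qx.
by split; [apply: qK; lia|rewrite mem_shown; apply/negP].
Qed.

Lemma size_markers (A : set T) k : [set` s] `<=` A -> A #<= `I_k -> size s <= k.
Proof.
move=> /subset_card_le sA Ak; have := card_le_trans sA Ak.
by rewrite (card_le_eql (card_seq_set _ _ us)) card_le_II.
Qed.

Lemma card_le_markers (A : set T) : A `<=` [set` s] -> A #<= `I_(size s).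
Proof.
by move=> /subset_card_le; rewrite (card_le_eqr (card_seq_set _ _ us)).
Qed.

Lemma marker_collection_omissions k :
  k < size s -> generatable_omissions k marker_collection.
Proof.
move=> ks.
have [f fP] := choice (fun l => fresh_index _ p l pI).
have [g gP] := choice (fun l => fresh_index _ q l qI).
exists (switch (has (mem s)) f g) => K CK x [xI xK omit].
apply: switch_correct => //; case: CK => [mK|uK]; [left|right]; split=> //.
  (* Otherwise all [size s > k] markers would be omitted. *)
  have [y ys [j _ xj]] : exists2 y, y \in s & range x y.
    apply: contrapT => h; have : size s <= k; last by lia.
    apply: (size_markers _ _ _ omit) => y ys; split; first exact: mK.1.
    by move=> xy; apply: h; exists y.
  exists j => t jt; apply/hasP; exists y => //.
  by rewrite -mem_shown; exists j.
move=> t; apply/hasPn => y; rewrite -mem_shown => -[j _ <-].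
by apply/negP => /uK.1; apply; apply: xK; exists j.
Qed.

Lemma marker_collection_noise k :
  k < size s -> generatable_noise k marker_collection.
Proof.
move=> ks.
have [f fP] := choice (fun l => fresh_index _ p l pI).
have [g gP] := choice (fun l => fresh_index _ q l qI).
exists (switch (fun l => all (mem l) s) f g) => K CK x [xI Kx noise].
apply: switch_correct => //; case: CK => [mK|uK]; [left|right]; split=> //.
  have /choice[h hP] : forall y, exists j, y \in s -> x j = y.
    move=> y; have [ys|] := boolP (y \in s); last by exists 0.
    by have [j _ xj] := Kx _ (mK.1 _ ys); exists j.
  (* By this time every marker has been shown. *)
  exists (\max_(y <- s) h y) => t ht; apply/allP => y ys /=.
  rewrite -mem_shown; exists (h y); last exact: hP.
  by apply: leq_trans ht; apply: leq_bigmax_seq.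
move=> t; apply/negP => /allP h; have : size s <= k; last by lia.
apply: (size_markers _ _ _ noise) => y ys; split; last exact: uK.1.
by have /= := h _ ys; rewrite -mem_shown => -[j _ <-]; exists j.
Qed.

(** * The adversary's play *)

Section Adversary.
(* [s0] lists the markers that the adversary shows: all of them, or none. *)
Variables (s0 : seq T) (G : generator T).
Hypotheses (us0 : uniq s0) (s0s : {subset s0 <= s}).

Definition admissible (x : nat -> T) := [/\ injective x,
  [set` s0] `<=` range x & range x `<=` [set` s0] `|` range p `|` range q].

(** One game serves both lower bounds: for [s0] empty, the targets here and in [G_unmarked] differ
    from [range x] at most by omitted markers; for [s0 = s], at most by markers shown as noise. *)
Hypothesis G_marked : forall x, admissible x -> range p `<=` range x ->
  eventually_correct G (range x `|` [set` s]) x.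
Hypothesis G_unmarked : forall x, admissible x ->
  (exists N, forall n, N <= n -> range x (q n)) ->
  eventually_correct G (range x `\` [set` s]) x.

(* In [n, l, j]: [l] is the play so far, it shows [p k] exactly for [k < n], and
   every [q k] that it shows or that has been given up has [k < j]. *)
Definition state_inv (st : nat * seq T * nat) := let: (n, l, j) := st in
  [/\ uniq l, {subset s0 <= l}, (forall k, k < n -> p k \in l) &
    forall y, y \in l -> [\/ y \in s0, exists2 k, k < n & y = p k |
                            exists2 k, k < j & y = q k]].

(** Freezing the unseen [q k] with [k < j] makes errors permanent: [q r] is unseen when output and
    can never be shown later. *)
Definition state_step (st st' : nat * seq T * nat) :=
  let: (n, l, j) := st in let: (n', l', j') := st' in
  [/\ n' = n.+1, prefix l l', j <= j',
    (forall k, k < j -> q k \in l' -> q k \in l) &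
    exists t r, [/\ size l <= t, t < size l', G (take t.+1 l') = q r,
                    r < j' & q r \notin l']].

(** Continue [l] with [q j, q j.+1, ...]. If this went on forever, the unmarked target would force
    an output among the terms still to come; the round stops there and plays [p n] instead. *)
Lemma state_step_ex st : state_inv st ->
  exists st', state_inv st' /\ state_step st st'.
Proof.
case: st => [[n l] j] [ul s0l pl lP].
pose x k := if k < size l then nth (q 0) l k else q (j + (k - size l)).
have qNl k : j <= k -> q k \notin l.
  move=> jk; apply/negP => /lP[/s0s|[m _ e]|[m mj /qI]]; last by lia.
    by rewrite (negPf (qNs k)).
  by apply: (pNq m k).
have xl k : k < size l -> x k \in l by move=> kl; rewrite /x kl mem_nth.
have xq k : size l <= k -> x k = q (j + (k - size l)).
  by rewrite /x leqNgt => /negPf ->.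
have lx y : y \in l -> exists2 k, k < size l & x k = y.
  move=> yl; exists (index y l); first by rewrite index_mem.
  by rewrite /x index_mem yl nth_index.
have xI : injective x.
  move=> a b; have [al|la] := ltnP a (size l); have [bl|lb] := ltnP b (size l).
  - by rewrite /x al bl => /eqP; rewrite nth_uniq// => /eqP.
  - move=> e; have := xl _ al; rewrite e (xq _ lb) => h.
    by have := qNl (j + (b - size l)) (leq_addr _ _); rewrite h.
  - move=> e; have := xl _ bl; rewrite -e (xq _ la) => h.
    by have := qNl (j + (a - size l)) (leq_addr _ _); rewrite h.
  - by rewrite (xq _ la) (xq _ lb) => /qI; lia.
have xadm : admissible x.
  split=> // [y /s0l /lx[k _ <-]|_ [k _ <-]]; first by exists k.
  have [/xl/lP[h|[m _ ->]|[m _ ->]]|/xq ->] := ltnP k (size l).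
  - by left; left.
  - by left; right; exists m.
  - by right; exists m.
  - by right; exists (j + (k - size l)).
have [|t0 Gt] := G_unmarked _ xadm.
  exists j => m jm; exists (m - j + size l) => //.
  by rewrite xq ?leq_addl// addnK subnKC.
(* Waiting for [size l] too puts the output beyond [l], where [x] runs through [q] only. *)
pose t := maxn t0 (size l).
have [[[k _ xk] _] Gx] := Gt t (leq_maxl _ _).
have tk : t < k by rewrite ltnNge; apply/negP => kt; apply: Gx; exists k.
have lt : size l <= t := leq_maxr _ _.
have lk : size l <= k by lia.
pose r := j + (k - size l).
have xkr : x k = q r := xq _ lk.
have xNk m : x m = q r -> m = k by rewrite -xkr => /xI.
have mem_mkseq y : y \in mkseq x t.+1 ->
    y \in l \/ exists2 m, j <= m < r & y = q m.
  move=> /mapP[m]; rewrite mem_iota => /andP[_ mt] ->.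
  have [ml|lm] := ltnP m (size l); [by left; exact: xl|right].
  by exists (j + (m - size l)); [rewrite /r; lia|exact: xq].
have l_mkseq y : y \in l -> y \in mkseq x t.+1.
  by move=> /lx[m ml <-]; apply: map_f; rewrite mem_iota; lia.
(* The new bound [r.+1] gives up [q r] and every earlier unseen term of [q]. *)
exists (n.+1, rcons (mkseq x t.+1) (p n), r.+1); split; split=> //.
- rewrite rcons_uniq mkseq_uniq// andbT; apply/negP.
  case/mem_mkseq=> [/lP[/s0s|[m mn /pI e]|[m _ /pNq//]]|[m _ /pNq//]].
    by rewrite (negPf (pNs n)).
  by lia.
- by move=> y /s0l /l_mkseq h; rewrite mem_rcons inE h orbT.
- move=> m; rewrite ltnS leq_eqVlt mem_rcons inE => /orP[/eqP->|/pl/l_mkseq->].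
    by rewrite eqxx.
  by rewrite orbT.
- move=> y; rewrite mem_rcons inE => /orP[/eqP ->|]; first by constructor 2; exists n.
  case/mem_mkseq => [/lP[h|[m mn ->]|[m mj ->]]|[m mr ->]].
  + by constructor 1.
  + by constructor 2; exists m => //; lia.
  + by constructor 3; exists m => //; rewrite /r; lia.
  + by constructor 3; exists m => //; lia.
- have l_le : size l <= size (mkseq x t.+1) by rewrite size_mkseq; lia.
  rewrite prefixE -cats1 takel_cat//.
  apply/eqP; apply: (@eq_from_nth _ (q 0)); rewrite size_takel// => m ml.
  have mt : m < t.+1 := leq_trans ml (leqW lt).
  by rewrite nth_take// nth_mkseq// /x ml.
- by rewrite /r; lia.
- move=> m mj; rewrite mem_rcons inE => /orP[/eqP/esym/pNq//|].
  by case/mem_mkseq=> // -[m' /[swap] /qI e h]; exfalso; lia.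
- exists t, r; split=> //.
  + by rewrite size_rcons size_mkseq; lia.
  + by rewrite -cats1 take_size_cat ?size_mkseq// -xkr xk.
  + rewrite mem_rcons inE; apply/norP; split; first by apply/eqP => /esym/pNq.
    by apply/mapP => -[m]; rewrite mem_iota => /andP[_ mt] /esym/xNk; lia.
Qed.

(** The limit play shows all of [p], so the marked target applies; yet each round contains an output
    [q r] that is neither a marker nor ever shown. *)
Lemma adversary_wins : False.
Proof.
have /choice[F FP] st : exists st', state_inv st -> state_inv st' /\ state_step st st'.
  have [h|h] := pselect (state_inv st); last by exists st.
  by have [st' ?] := state_step_ex _ h; exists st'.
pose st n := iter n F (0, s0, 0); pose L n := (st n).1.2; pose J n := (st n).2.
have inv n : state_inv (st n).
  elim: n => [|n /FP[]//]; split=> // y; first by constructor 1.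
have step n : state_step (st n) (st n.+1) by have [] := FP _ (inv n).
have stE n : st n = (n, L n, J n).
  elim: n => [//|n IH]; have := step n; rewrite IH /L /J.
  by case: (st n.+1) => [[a b] c] [-> *].
have {}inv n : state_inv (n, L n, J n) by rewrite -stE.
have {}step n : state_step (n, L n, J n) (n.+1, L n.+1, J n.+1) by rewrite -!stE.
have L_prefix m n : m <= n -> prefix (L m) (L n).
  elim: n => [|n IH]; first by rewrite leqn0 => /eqP ->; exact: prefix_refl.
  rewrite leq_eqVlt => /orP[/eqP ->|/IH h]; first exact: prefix_refl.
  by apply: prefix_trans h _; have [] := step n.
have J_mono m n : m <= n -> J m <= J n.
  elim: n => [|n IH]; first by rewrite leqn0 => /eqP ->.
  rewrite leq_eqVlt => /orP[/eqP -> //|/IH h].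
  by apply: leq_trans h _; have [] := step n.
have q_frozen m n k : m <= n -> k < J m -> q k \in L n -> q k \in L m.
  elim: n => [|n IH]; first by rewrite leqn0 => /eqP ->.
  rewrite leq_eqVlt => /orP[/eqP -> //|mn] km qn; have [_ _ _ h _] := step n.
  by apply: IH => //; apply: h => //; apply: leq_trans km (J_mono m n mn).
have L_size n : n <= size (L n).
  elim: n => // n IH; have [_ _ _ _ [t [r []]]] := step n; lia.
(* By [L_size], position [k] exists in [L k.+1], so the default [q 0] is never read. *)
pose x k := nth (q 0) (L k.+1) k.
have xL n k : k < size (L n) -> x k = nth (q 0) (L n) k.
  move=> kn; have kk : k < size (L k.+1) := L_size k.+1.
  have [/L_prefix|/ltnW/L_prefix] := leqP n k.+1.
    by case/prefixP=> l' e; rewrite /x e nth_cat kn.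
  by case/prefixP=> l' e; rewrite e nth_cat kk.
have x_mem k : x k \in L k.+1 by apply: mem_nth; exact: L_size.
have L_range n y : y \in L n -> range x y.
  move=> yn; exists (index y (L n)) => //.
  by rewrite (xL n) ?index_mem// nth_index.
have xI : injective x.
  move=> a b; pose n := (maxn a b).+1; have nL := L_size n.
  have an : a < size (L n) by lia.
  have bn : b < size (L n) by lia.
  rewrite (xL _ _ an) (xL _ _ bn) => /eqP.
  by rewrite nth_uniq// => [/eqP//|]; have [] := inv n.
have xadm : admissible x.
  split=> // [y ys|_ [k _ <-]].
    by apply: (L_range 0); have [_ h _ _] := inv 0; exact: h.
  have [_ _ _ /(_ _ (x_mem k))[h|[m _ ->]|[m _ ->]]] := inv k.+1.
  - by left; left.
  - by left; right; exists m.
  - by right; exists m.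
have [_ [n _ <-]|t0 Gt] := G_marked _ xadm.
  by apply: (L_range n.+1); have [_ _ h _] := inv n.+1; exact: h.
(* The round after [L t0] errs at a time [t >= size (L t0) >= t0]. *)
have [_ _ _ _ [t [r [lt tl Gq rJ qL]]]] := step t0.
have /Gt : t0 <= t by apply: leq_trans lt; exact: L_size.
rewrite /output; have -> : mkseq x t.+1 = take t.+1 (L t0.+1).
  apply: (@eq_from_nth _ (q 0)); rewrite size_mkseq ?size_takel// => k kt.
  by rewrite nth_mkseq// nth_take// -xL//; lia.
rewrite Gq => -[[[k _ xk]|/= qs] _]; last by rewrite (negPf (qNs r)) in qs.
(* If [q r] is [x k], it lies in [L t0.+1]: by the prefix order when [k <= t0], by freezing
   otherwise. *)
move/negP: qL; apply; have [kt|tk] := leqP k t0.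
  by rewrite -xk; have /prefixP[l' ->] := L_prefix k.+1 t0.+1 kt; rewrite mem_cat x_mem.
by apply: (q_frozen t0.+1 k.+1) => //; [lia|rewrite -xk].
Qed.

End Adversary.

(** * The two lower bounds *)

Lemma marker_collection_not_omissions :
  ~ generatable_omissions (size s) marker_collection.
Proof.
move=> [G HG]; apply: (@adversary_wins [::] G) => // x [xI _ xpq].
  move=> px; apply: HG; first by left; split=> [|y /px]; [exact: subsetUr|left].
  split=> //.
  by apply: card_le_markers => y [[]].
have xNs y : y \in s -> ~ range x y.
  by move=> ys /xpq[[//|[n _ e]]|[n _ e]]; move: ys; rewrite -e ?(negPf (pNs n)) ?(negPf (qNs n)).
move=> [N qx]; apply: HG; first right; split=> //.
- by move=> y ys [].
- by exists N => n /qx ?; split=> //; apply/negP.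
- by move=> y xy; split=> // ys; exact: (xNs y).
- by apply: card_le_markers => y [[]].
Qed.

Lemma marker_collection_not_noise :
  ~ generatable_noise (size s) marker_collection.
Proof.
move=> [G HG]; apply: (@adversary_wins s G) => // x [xI sx xpq].
  move=> px; apply: HG; first by left; split=> [|y /px]; [exact: subsetUr|left].
  split=> //; first by move=> y [//|/sx].
  by apply: card_le_markers => y [xy []]; left.
move=> [N qx]; apply: HG; first right; split=> //.
- by move=> y ys [].
- by exists N => n /qx ?; split=> //; apply/negP.
- apply: card_le_markers => y [xy nK]; apply: contrapT => ys.
  by apply: nK.
Qed.

End MarkerCollection.

Theorem theorem1p4 (U : Type) (hU : [set: U] #= [set: nat]) (i : nat) :
  exists C : set (set U),
    collection C /\
    (generatable_omissions i C /\ generatable_noise i C) /\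
    (~ generatable_omissions i.+1 C /\ ~ generatable_noise i.+1 C).
Proof.
(* Classically [U] is a [choiceType], as membership in sequences requires. *)
elim/Pchoice: U => U in hU *.
have [e eI] : exists e : nat -> U, injective e.
  move: hU; rewrite card_eq_sym => /card_eqPle[/card_leP[f] _].
  exists (fun n => val (f (to_setT n))) => a b /val_inj /(@inj _ _ _ f).
  by rewrite !inE => /(_ I I) /(congr1 val).
pose s := map e (iota 0 i.+1).
(* Past the [i.+1] markers, even offsets go to [p] and odd ones to [q]. *)
pose p n := e (i.+1 + n.*2); pose q n := e (i.+1 + n.*2.+1).
have us : uniq s by rewrite map_inj_uniq ?iota_uniq.
have ss : size s = i.+1 by rewrite size_map size_iota.
have pI : injective p by move=> a b /eI; lia.
have qI : injective q by move=> a b /eI; lia.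
have pNq a b : p a <> q b by move=> /eI; lia.
have pNs n : p n \notin s by rewrite /p /q /s mem_map// mem_iota; lia.
have qNs n : q n \notin s by rewrite /p /q /s mem_map// mem_iota; lia.
exists (marker_collection U s p q); split; first exact: marker_collection_infinite.
split; split.
- by apply: marker_collection_omissions; rewrite ?ss.
- by apply: marker_collection_noise; rewrite ?ss.
- by rewrite -ss; apply: marker_collection_not_omissions.
- by rewrite -ss; apply: marker_collection_not_noise.
Qed.
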